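(* Let $\beta_1,\beta_2$ be two reduced positive braid words on $n$ strands, of lengths $\ell(\beta_1),\ell(\beta_2)$, and let $w_1,w_2\in S_n$ be their Coxeter projections. (a) The map $\iota:\mathbb C^{\ell(\beta_1)}\times\mathbb C^{\ell(\beta_2)}\to\mathcal{F}\ell_n$, $(z_1,z_2)\mapsto\mathcal F^{B_{\beta_1}^{-1}(z_1)}$, restricts to an isomorphism $$X(\beta_1\beta_2;w_0)\longrightarrow\iota(X(\beta_1\beta_2;w_0))\cong X^\circ_{w_1^{-1}}\cap X^{\circ,\,w_2w_0}$$ of affine algebraic varieties. (b) The map $\jmath:\mathbb C^{\ell(\beta_1)}\times\mathbb C^{\ell(\beta_2)}\to\mathcal{F}\ell_n$, $(z_1,z_2)\mapsto\mathcal F^{w_0B_{\beta_1}^{-1}(z_1)}$, restricts to an isomorphism $$X(\beta_1\beta_2;w_0)\longrightarrow\jmath(X(\beta_1\beta_2;w_0))\cong X^{\circ,\,w_0w_1^{-1}}\cap X^\circ_{w_2^*}$$ of affine algebraic varieties.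
   Context: $G=\mathrm{GL}(n,\mathbb C)$, $B$ and $B_-$ are the subgroups of upper, resp. lower, triangular matrices, $\mathcal{F}\ell_n=G/B$. For $A\in G$, $\mathcal F^A$ is the flag whose $i$-th subspace is spanned by the first $i$ columns of $A$. Permutations are identified with permutation matrices and multiplied as functions; $w_0\in S_n$ is the longest element and $w^*:=w_0ww_0$. The Schubert cell and opposite Schubert cell of $w\in S_n$ are $X^\circ_w:=BwB/B$ and $X^{\circ,w}:=B_-wB/B$. The Coxeter projection of a braid word is obtained by replacing each $\sigma_i$ by $s_i=(i\ i{+}1)$. $B_i(z)\in\mathrm{GL}(n,\mathbb C[z])$ is the identity except for the block $\begin{pmatrix}0&1\\1&z\end{pmatrix}$ in rows and columns $i,i+1$; for a positive word $\gamma=\sigma_{a_1}\cdots\sigma_{a_m}$, $B_\gamma(z)=B_{a_1}(z_1)\cdots B_{a_m}(z_m)$ for $z=(z_1,\dots,z_m)$. The braid variety is $X(\gamma;\pi)=\{z\in\mathbb C^m: B_\gamma(z)\pi\text{ is upper triangular}\}$ for $\pi\in S_n$. *)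

(* Defs.v *)
From mathcomp Require Import all_boot all_order all_algebra all_fingroup.
From mathcomp Require Import complex mpoly boolp classical_sets reals.

Set Implicit Arguments.
Unset Strict Implicit.
Unset Printing Implicit Defensive.
Import GRing.Theory.
Local Open Scope classical_set_scope.
Local Open Scope ring_scope.

(** Varieties are encoded as spaces with functions.

    A variety is a set with a Zariski topology and, on every open set, a
    notion of regular K-valued function.  The points live in an ambient type T,
    so that [regular X U f] only constrains the values of [f] on [U]. *)

Record kspace (K : fieldType) (T : Type) := KSpace {
  carrier : set T;
  isopen : set T -> Prop;
  regular : set T -> (T -> K) -> Prop }.

Section Spaces.
Variable K : fieldType.

(** Affine m-space whose points are the elements of T, with coordinates [x]. *)
Section Affine.
Variables (T : Type) (m : nat) (x : T -> 'I_m -> K).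

Definition zero_locus (S : set {mpoly K[m]}) : set T :=
  [set t | forall p, S p -> p.@[x t] = 0].

Definition zariski_closed (Z : set T) : Prop := exists S, Z = zero_locus S.

Definition affine_space : kspace K T :=
  {| carrier := setT;
     isopen := fun U => zariski_closed (~` U);
     regular := fun U f => zariski_closed (~` U) /\
       forall t, U t -> exists (V : set T) (p q : {mpoly K[m]}),
         [/\ zariski_closed (~` V), V t, V `<=` U &
             forall u, V u -> q.@[x u] != 0 /\ f u = p.@[x u] / q.@[x u]] |}.

End Affine.

Definition subspace (T : Type) (X : kspace K T) (Y : set T) : kspace K T :=
  let op V := exists2 U, isopen X U & V = U `&` Y in
  {| carrier := carrier X `&` Y;
     isopen := op;
     regular := fun V f => op V /\
       forall t, V t -> exists (U : set T) (g : T -> K),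
         [/\ isopen X U, U t, regular X U g &
             forall u, U u -> V u -> f u = g u] |}.

(** The quotient of X by the equivalence relation [q s = q t]. *)
Definition quotient_space (S T : Type) (X : kspace K S) (q : S -> T) :
    kspace K T :=
  let pre U := carrier X `&` q @^-1` U in
  let op U := U `<=` q @` carrier X /\ isopen X (pre U) in
  {| carrier := q @` carrier X;
     isopen := op;
     regular := fun U f => op U /\ regular X (pre U) (f \o q) |}.

Definition morphism (S T : Type) (X : kspace K S) (Y : kspace K T)
    (f : S -> T) : Prop :=
  let pre V := carrier X `&` f @^-1` V in
  [/\ forall s, carrier X s -> carrier Y (f s),
      forall V, isopen Y V -> isopen X (pre V) &
      forall V g, regular Y V g -> regular X (pre V) (g \o f)].

Definition isomorphism (S T : Type) (X : kspace K S) (Y : kspace K T)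
    (f : S -> T) : Prop :=
  morphism X Y f /\
  exists g : T -> S,
    [/\ morphism Y X g,
        forall s, carrier X s -> g (f s) = s &
        forall t, carrier Y t -> f (g t) = t].

Definition Aff (m : nat) : kspace K 'rV[K]_m :=
  affine_space (fun (z : 'rV[K]_m) i => z 0 i).

Definition affine_variety (T : Type) (X : kspace K T) : Prop :=
  exists (m : nat) (Z : set 'rV[K]_m) (f : T -> 'rV[K]_m),
    zariski_closed (fun (z : 'rV[K]_m) i => z 0 i) Z /\
    isomorphism X (subspace (Aff m) Z) f.

Definition affine_isomorphism (S T : Type) (X : kspace K S) (Y : kspace K T)
    (f : S -> T) : Prop :=
  [/\ affine_variety X, affine_variety Y & isomorphism X Y f].

End Spaces.

(** Mathcomp multiplies permutations from left to right; [perm_comp u v] is the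
    composite function u o v. *)
Definition perm_comp (n : nat) (u v : 'S_n) : 'S_n := (v * u)%g.

Lemma perm_compE n (u v : 'S_n) i : perm_comp u v i = u (v i).
Proof. exact: permM. Qed.

Definition w0 (n : nat) : 'S_n := perm (@rev_ord_inj n).

Definition wstar (n : nat) (w : 'S_n) : 'S_n := perm_comp (perm_comp (w0 n) w) (w0 n).

Section Words.
Variable n : nat.
Implicit Type i : 'I_n.-1.

(** The generators are numbered from 0: the letter [i] stands for the crossing
    of the strands in positions i and i+1, counted from 0. *)
Lemma strand_lo_subproof i : (i < n)%N.
Proof. exact: leq_trans (ltn_ord i) (leq_pred n). Qed.

Lemma strand_hi_subproof i : (i.+1 < n)%N.
Proof. by rewrite -ltn_predRL. Qed.

Definition strand_lo i : 'I_n := Ordinal (strand_lo_subproof i).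
Definition strand_hi i : 'I_n := Ordinal (strand_hi_subproof i).

Definition simple_refl i : 'S_n := tperm (strand_lo i) (strand_hi i).

Definition coxeter (b : seq 'I_n.-1) : 'S_n :=
  foldr (fun i w => perm_comp (simple_refl i) w) 1%g b.

Definition reduced (b : seq 'I_n.-1) : Prop :=
  forall c : seq 'I_n.-1, coxeter c = coxeter b -> (size b <= size c)%N.

End Words.

Section Braid.
Variables (K : fieldType) (n : nat).

(** Column j of the matrix of w is the basis vector e_(w j); this convention
    is multiplicative for [perm_comp] (mathcomp's [perm_mx] is its transpose). *)
Definition pmat (w : 'S_n) : 'M[K]_n := \matrix_(i, j) (i == w j)%:R.

Lemma pmatM (u v : 'S_n) : pmat (perm_comp u v) = pmat u *m pmat v.
Proof.
apply/matrixP => i j; rewrite !mxE (bigD1 (v j)) //= !mxE eqxx mulr1 perm_compE.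
by rewrite big1 ?addr0 // => k /negPf kv; rewrite !mxE kv mulr0.
Qed.

Definition Bgen (a : 'I_n.-1) (z : K) : 'M[K]_n :=
  \matrix_(i, j)
    let lo := strand_lo a in let hi := strand_hi a in
    if (i == lo) && (j == lo) then 0
    else if (i == lo) && (j == hi) then 1
    else if (i == hi) && (j == lo) then 1
    else if (i == hi) && (j == hi) then z
    else (i == j)%:R.

Definition Bword (m : nat) (b : m.-tuple 'I_n.-1) (z : 'rV[K]_m) : 'M[K]_n :=
  \prod_(k < m) Bgen (tnth b k) (z 0 k).

Definition upper_triangular (A : 'M[K]_n) : bool := is_trig_mx A^T.

Definition braid_variety (m : nat) (b : m.-tuple 'I_n.-1) (w : 'S_n) :
    set 'rV[K]_m :=
  [set z | upper_triangular (Bword b z *m pmat w)].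

Definition borel : set 'M[K]_n :=
  [set A | A \in unitmx /\ upper_triangular A].

Definition borel_opp : set 'M[K]_n := [set A | A \in unitmx /\ is_trig_mx A].

Definition flag : Type := {ffun 'I_n.+1 -> {vspace 'cV[K]_n}}.

Definition flag_of (A : 'M[K]_n) : flag :=
  [ffun i : 'I_n.+1 => (\sum_(j < n | (j < i)%N) <[col j A]>)%VS].

Lemma flag_ofE A (i : 'I_n.+1) :
  flag_of A i = (\sum_(j < n | (j < i)%N) <[col j A]>)%VS.
Proof. by rewrite ffunE. Qed.

Lemma mem_flag_of A (i : 'I_n.+1) (j : 'I_n) :
  (j < i)%N -> col j A \in flag_of A i.
Proof.
by move=> ji; rewrite flag_ofE memvE; apply: (sumv_sup j).
Qed.

Lemma col_mulmx (A b : 'M[K]_n) j :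
  col j (A *m b) = \sum_k b k j *: col k A.
Proof.
apply/matrixP => r s; rewrite !mxE summxE.
by apply: eq_bigr => k _; rewrite !mxE mulrC.
Qed.

Lemma flag_of_eqP (A A' : 'M[K]_n) : A \in unitmx -> A' \in unitmx ->
  flag_of A = flag_of A' <-> exists2 b, borel b & A' = A *m b.
Proof.
move=> uA uA'; split=> [eqF | [b [ub tb] ->]].
  exists (invmx A *m A'); last by rewrite mulKVmx.
  split; first by rewrite unitmx_mul unitmx_inv uA.
  apply/is_trig_mxP => j k jk; rewrite mxE.
  have := @mem_flag_of A' (lift ord0 j) j; rewrite /= /bump /= add1n ltnSn.
  move=> /(_ isT); rewrite -eqF flag_ofE => /memv_sumP[vs Hvs E].
  have -> : (invmx A *m A') k j = (invmx A *m col j A') k 0.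
    by rewrite !mxE; apply: eq_bigr => r _; rewrite !mxE.
  rewrite E mulmx_sumr summxE big1 // => r rj.
  have /vlineP[c ->] := Hvs r rj.
  rewrite -scalemxAr colE mulKmx // !mxE andbT; case: eqP => [kr|]; last first.
    by rewrite mulr0.
  by move: rj; rewrite /= /bump /= add1n ltnS -kr leqNgt jk.
have b0 (k j : 'I_n) : (j < k)%N -> b k j = 0.
  by move=> jk; have /is_trig_mxP/(_ _ _ jk) := tb; rewrite mxE.
have bjj (j : 'I_n) : b j j != 0.
  have : \det b^T \is a GRing.unit by rewrite det_tr -unitmxE.
  rewrite det_trig // unitfE => /prodf_neq0/(_ j isT).
  by rewrite mxE.
have key (i : 'I_n.+1) (m : nat) (j : 'I_n) : (j < m)%N -> (j < i)%N ->
    col j A \in flag_of (A *m b) i.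
  elim: m j => // m IH j jm ji.
  have -> : col j A = (b j j)^-1 *: (col j (A *m b) -
       \sum_(k < n | k != j) b k j *: col k A).
    by rewrite col_mulmx (bigD1 j) //= addrK scalerA mulVf ?scale1r.
  apply/rpredZ/rpredB; first exact: mem_flag_of.
  apply: rpred_sum => k kj; case: (ltngtP k j) => [lt|gt|/val_inj e].
  - apply/rpredZ/IH; [exact: leq_trans lt _ | exact: ltn_trans lt _].
  - by rewrite b0 // scale0r rpred0.
  - by rewrite e eqxx in kj.
apply/ffunP => i; apply/eqP; rewrite eqEsubv; apply/andP; split.
  rewrite [flag_of A i]flag_ofE; apply/subv_sumP => j ji.
  by rewrite -memvE; apply: (key i j.+1).
rewrite [flag_of (A *m b) i]flag_ofE; apply/subv_sumP => j ji.
rewrite -memvE col_mulmx; apply: rpred_sum => k _.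
case: (leqP k j) => [kj|jk]; last by rewrite b0 // scale0r rpred0.
by apply/rpredZ/mem_flag_of/(leq_ltn_trans kj).
Qed.

Definition GL : kspace K 'M[K]_n :=
  subspace (affine_space (fun (A : 'M[K]_n) k => mxvec A 0 k))
           [set A | A \in unitmx].

(** Two invertible matrices have the same flag iff they differ by right
    multiplication by an element of [borel] ([flag_of_eqP]), so this quotient
    is G/B. *)
Definition Fl : kspace K flag := quotient_space GL flag_of.

Definition schubert (w : 'S_n) : set flag :=
  [set F | exists b c, [/\ borel b, borel c & F = flag_of (b *m pmat w *m c)]].

Definition schubert_opp (w : 'S_n) : set flag :=
  [set F | exists b c,
     [/\ borel_opp b, borel c & F = flag_of (b *m pmat w *m c)]].

End Braid.

(* Main.v *)
From mathcomp Require Import all_boot all_order all_algebra all_fingroup zify.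
From mathcomp Require Import complex mpoly boolp classical_sets reals.
Require Import Defs.

Set Implicit Arguments.
Unset Strict Implicit.
Unset Printing Implicit Defensive.
Import GRing.Theory.
Local Open Scope classical_set_scope.
Local Open Scope ring_scope.

(** Write B_1, B_2 for the braid matrices of the two words, U and U_- for the
    upper and lower unipotent groups, and v = w_2 w_0.  A point (z_1, z_2) lies on
    the braid variety iff B_1(z_1) B_2(z_2) w_0 is in B, that is, iff B_1(z_1)^-1
    and B_2(z_2) w_0 have the same flag.

    The braid matrix of a reduced word with projection w is M w with M in the
    group U_- meet w U w^-1 ([word_unip_supp]).  Hence B_1^-1 lies in U w_1^-1 and
    in w_1^-1 U_-, while B_2 w_0 lies in U_- v and in v U_-.  The first inclusion
    of each pair puts the flag in the two cells.  Conversely each letter of a word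
    has a parameter with which it can clear one matrix entry, so every flag of the
    first cell comes from some B_1(z_1)^-1 and every flag of the second from some
    B_2(z_2) w_0 ([word_mx_borel], [word_mx_borel_opp]); a flag in both cells then
    gives a point of the braid variety ([image_iota]).

    The second inclusion of each pair produces the inverse map.  On the open set
    w U_- B / B of the flag variety, the factor in U_- of w^-1 A is given by
    quotients of flag minors ([lower_factor]), which are right B-invariant, hence
    regular functions on that open subset of G/B.  From M the parameters are read off one
    letter at a time: the first is the entry of M at a simple root, and clearing it
    leaves the M of the remaining word ([word_paramsK]).  So z_1 and z_2 are
    restrictions of regular functions on a neighbourhood of the image
    ([chart_paramsK]), and the map is an isomorphism onto its image.

    Left multiplication by a fixed invertible matrix P changes nothing in this
    argument; P = 1 is part (a), and P = w_0, which exchanges B and B_-, is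
    part (b). *)

(** * Spaces with functions *)

Section Morphisms.
Variable K : fieldType.

(** A map on a locally closed subset is most easily shown to be a morphism by
    extending it to a neighbourhood [D], over which it need not take its values in
    the intended target; hence no condition on where the points go. *)
Definition morphism_on (S T : Type) (X : kspace K S) (D : set S)
    (Y : kspace K T) (f : S -> T) : Prop :=
  (forall U, isopen Y U -> isopen X (D `&` f @^-1` U)) /\
  (forall U g, regular Y U g -> regular X (D `&` f @^-1` U) (g \o f)).

Lemma morphism_on_sub S T (X : kspace K S) (Y : kspace K T) D A B f :
  morphism_on X D Y f -> D `<=` carrier X -> carrier X `&` A `<=` D ->
  (forall s, carrier X s -> A s -> carrier Y (f s) /\ B (f s)) ->
  morphism (subspace X A) (subspace Y B) f.
Proof.
move=> [fo fr] DX AD fAB.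
have pre U : carrier X `&` A `&` f @^-1` (U `&` B) = D `&` f @^-1` U `&` A.
  apply/predeqP => s; split=> [[[Xs As] [Us _]]|[[Ds Us] As]].
    by split=> //; split=> //; apply: AD.
  have Xs := DX _ Ds; have [_ Bs] := fAB s Xs As.
  by split; split.
have op V : isopen (subspace Y B) V ->
    isopen (subspace X A) (carrier X `&` A `&` f @^-1` V).
  by case=> U oU ->; exists (D `&` f @^-1` U); [apply: fo | apply: pre].
split=> [s [Xs As]|//|V g [oV gV]]; first exact: fAB.
split; first exact: op.
move=> s [[Xs As] Vs]; have [U [h [oU Us rh gh]]] := gV _ Vs.
exists (D `&` f @^-1` U), (h \o f); split.
- exact: fo.
- by split=> //; apply: AD.
- exact: fr.
- by move=> u [Du Uu] [_ Vu]; apply: gh.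
Qed.

(** Regularity on a subspace only sees the values of the function, whence the
    freedom to change the map outside the set considered. *)
Lemma morphism_on_subl S T (X : kspace K S) (Y : kspace K T) D A f f' :
  (forall U g, regular Y U g -> isopen Y U) ->
  morphism_on X D Y f -> (forall s, D s -> A s -> f' s = f s) ->
  morphism_on (subspace X A) (D `&` A) Y f'.
Proof.
move=> Yo [fo fr] ff'.
have pre U : D `&` A `&` f' @^-1` U = D `&` f @^-1` U `&` A.
  apply/predeqP => s; split=> [[[Ds As]]|[[Ds Us] As]]; rewrite /preimage /=.
    by rewrite ff'.
  by rewrite ff'.
split=> [U oU|U g rg].
  by exists (D `&` f @^-1` U); [apply: fo | apply: pre].
have oU := fo _ (Yo _ _ rg).
split; first by exists (D `&` f @^-1` U); [ | apply: pre].
move=> s; rewrite pre => -[[Ds Us] As].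
exists (D `&` f @^-1` U), (g \o f); split=> //; first exact: fr.
by move=> u [Du Uu] [_ Au] /=; rewrite ff'.
Qed.

Lemma morphism_on_quotient S T V (X : kspace K S) (q : S -> T) (Y : kspace K V)
    D f :
  (forall U g, regular Y U g -> isopen Y U) -> D `<=` q @` carrier X ->
  morphism_on X (carrier X `&` q @^-1` D) Y (f \o q) ->
  morphism_on (quotient_space X q) D Y f.
Proof.
move=> Yo DX [fo fr].
have pre U : carrier X `&` q @^-1` (D `&` f @^-1` U) =
    carrier X `&` q @^-1` D `&` (f \o q) @^-1` U by rewrite setIA.
have sub U : D `&` f @^-1` U `<=` q @` carrier X by move=> t [/DX].
have op U : isopen Y U -> isopen (quotient_space X q) (D `&` f @^-1` U).
  by move=> oU; split; rewrite ?pre; [apply: sub | apply: fo].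
split=> // U g rg; split; first exact/op/(Yo _ _ rg).
by rewrite pre; apply: (fr U g).
Qed.

Lemma morphism_comp S T V (X : kspace K S) (Y : kspace K T) (Z : kspace K V)
    f g :
  morphism X Y f -> morphism Y Z g -> morphism X Z (g \o f).
Proof.
move=> [fc fo fr] [gc go gr].
have pre U : carrier X `&` (g \o f) @^-1` U =
    carrier X `&` f @^-1` (carrier Y `&` g @^-1` U).
  apply/predeqP => s; split=> [[Xs Us]|[Xs [_ Us]]]; split=> //.
  by split=> //; apply: fc.
split=> [s /fc/gc //|U oU|U h rh]; first by rewrite pre; apply/fo/go.
by rewrite pre; apply: (fr _ _ (gr _ _ rh)).
Qed.

Lemma morphism_quotient S T (X : kspace K S) (q : S -> T) :
  morphism X (quotient_space X q) q.
Proof. by split=> [s Xs|U []|U g []] //; exists s. Qed.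

(** Regular functions on a subspace are only locally restrictions of regular
    functions, so pulling one back takes two local extensions in a row, whose
    domains must be intersected in [X]. *)
Lemma morphism_corestrict S T (X : kspace K S) A (Y : kspace K T) B f :
  (forall U V, isopen X U -> isopen X V -> isopen X (U `&` V)) ->
  (forall U V g, isopen X V -> regular X U g -> regular X (U `&` V) g) ->
  morphism (subspace X A) Y f ->
  (forall s, carrier X s -> A s -> B (f s)) ->
  morphism (subspace X A) (subspace Y B) f.
Proof.
move=> XI Xr [fc fo fr] fB.
have pre U : carrier X `&` A `&` f @^-1` (U `&` B) =
    carrier X `&` A `&` f @^-1` U.
  apply/predeqP => s; split=> [[XAs []]|[[Xs As] Us]] //.
  by split=> //; split=> //; apply: fB.
have op V : isopen (subspace Y B) V ->
    isopen (subspace X A) (carrier X `&` A `&` f @^-1` V).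
  by case=> U oU ->; rewrite pre; apply: fo.
split=> [s XAs|//|V g [oV gV]].
  by split; [apply: fc | case: XAs => ? ?; apply: fB].
split; first exact: op.
move=> s [XAs Vs]; have [U [h [oU Us rh gh]]] := gV _ Vs.
have [_ /(_ s (conj XAs Us))[W [k [oW Ws rk hk]]]] := fr _ _ rh.
have [W' oW' eW'] := fo _ oU.
have W's : W' s.
  by have : (carrier X `&` A `&` f @^-1` U) s by []; rewrite eW' => -[].
exists (W `&` W'), k; split=> //; [exact: XI | exact: Xr | ].
move=> u [Wu W'u] [[Xu Au] Vu].
have XAUu : (carrier X `&` A `&` f @^-1` U) u by rewrite eW'.
by rewrite -hk //=; apply: gh => //; case: XAUu.
Qed.

Lemma isomorphism_sym S T (X : kspace K S) (Y : kspace K T) f :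
  isomorphism X Y f -> exists g, isomorphism Y X g.
Proof. by move=> [fm [g [gm gf fg]]]; exists g; split=> //; exists f. Qed.

Lemma isomorphism_id S (X : kspace K S) :
  (forall U g, regular X U g -> U `<=` carrier X) ->
  (forall U, isopen X U -> U `<=` carrier X) ->
  isomorphism X X id.
Proof.
move=> Xr Xo.
have id_mor : morphism X X id.
  split=> // [U oU|U g rg].
    by rewrite setIidr //; apply: Xo.
  by rewrite setIidr //; apply: Xr rg.
by split=> //; exists id.
Qed.

End Morphisms.

(** * Polynomial and rational functions *)

Section FunctionAlgebras.
Variables (K : fieldType) (T : Type).
Implicit Type S : (T -> K) -> Prop.

(** Polynomial functions and fractions on an open set are both closed under these
    operations, so determinants, adjugates and products of matrices of such
    functions are treated once for both. *)
Definition function_algebra S :=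
  [/\ forall c, S (fun=> c),
      forall f g, S f -> S g -> S (fun t => f t + g t) &
      forall f g, S f -> S g -> S (fun t => f t * g t)].

Variables (S : (T -> K) -> Prop) (S_alg : function_algebra S).

Lemma alg_cst c : S (fun=> c).
Proof. by case: S_alg. Qed.

Lemma alg_add f g : S f -> S g -> S (fun t => f t + g t).
Proof. by case: S_alg => _ + _; apply. Qed.

Lemma alg_mul f g : S f -> S g -> S (fun t => f t * g t).
Proof. by case: S_alg => _ _; apply. Qed.

Lemma alg_opp f : S f -> S (fun t => - f t).
Proof.
move=> Sf; have -> : (fun t => - f t) = (fun t => -1 * f t).
  by apply/funext => t; rewrite mulN1r.
exact/alg_mul/Sf/alg_cst.
Qed.

Lemma alg_sum I (r : seq I) (P : pred I) (f : I -> T -> K) :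
  (forall i, S (f i)) -> S (fun t => \sum_(i <- r | P i) f i t).
Proof.
move=> Sf; elim: r => [|i r IH].
  by under eq_fun do rewrite big_nil; apply: alg_cst.
under eq_fun do rewrite big_cons; case: (P i) => //.
exact: alg_add.
Qed.

Lemma alg_prod I (r : seq I) (P : pred I) (f : I -> T -> K) :
  (forall i, S (f i)) -> S (fun t => \prod_(i <- r | P i) f i t).
Proof.
move=> Sf; elim: r => [|i r IH].
  by under eq_fun do rewrite big_nil; apply: alg_cst.
under eq_fun do rewrite big_cons; case: (P i) => //.
exact: alg_mul.
Qed.

Lemma alg_exp f k : S f -> S (fun t => f t ^+ k).
Proof.
move=> Sf; elim: k => [|k IH].
  by under eq_fun do rewrite expr0; apply: alg_cst.
by under eq_fun do rewrite exprS; apply: alg_mul.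
Qed.

Lemma alg_meval k (f : T -> 'I_k -> K) (p : {mpoly K[k]}) :
  (forall i, S (fun t => f t i)) -> S (fun t => p.@[f t]).
Proof.
move=> Sf; under eq_fun do rewrite mevalE.
apply: alg_sum => m; apply: alg_mul; first exact: alg_cst.
by apply: alg_prod => i; apply: alg_exp.
Qed.

Definition alg_mx (k l : nat) (A : T -> 'M[K]_(k, l)) :=
  forall i j, S (fun t => A t i j).

Lemma alg_mx_mul k l m (A : T -> 'M[K]_(k, l)) (B : T -> 'M[K]_(l, m)) :
  alg_mx A -> alg_mx B -> alg_mx (fun t => A t *m B t).
Proof.
move=> SA SB i j; under eq_fun do rewrite mxE.
by apply: alg_sum => h; apply: alg_mul.
Qed.

Lemma alg_mx_cst k l (A : 'M[K]_(k, l)) : alg_mx (fun=> A).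
Proof. by move=> i j; apply: alg_cst. Qed.

Lemma alg_det k (A : T -> 'M[K]_k) : alg_mx A -> S (fun t => \det (A t)).
Proof.
move=> SA; apply: alg_sum => s; apply: alg_mul; first exact: alg_cst.
exact: alg_prod.
Qed.

Lemma alg_mx_adj k (A : T -> 'M[K]_k) :
  alg_mx A -> alg_mx (fun t => \adj (A t)).
Proof.
move=> SA i j; under eq_fun do rewrite mxE.
apply: alg_mul; first exact: alg_cst.
by apply: alg_det => ? ?; under eq_fun do rewrite !mxE.
Qed.

End FunctionAlgebras.

Section RationalFunctions.
Variables (K : fieldType) (T : Type) (m : nat) (x : T -> 'I_m -> K).

Definition polyfun (f : T -> K) :=
  exists p : {mpoly K[m]}, forall t, f t = p.@[x t].

Definition fracfun (D : set T) (f : T -> K) :=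
  exists p q : {mpoly K[m]},
    forall t, D t -> q.@[x t] != 0 /\ f t = p.@[x t] / q.@[x t].

Lemma polyfun_alg : function_algebra polyfun.
Proof.
split=> [c|f g [p pE] [q qE]|f g [p pE] [q qE]].
- by exists c%:MP => t; rewrite mevalC.
- by exists (p + q) => t; rewrite mevalD pE qE.
- by exists (p * q) => t; rewrite mevalM pE qE.
Qed.

Lemma polyfun_coord i : polyfun (fun t => x t i).
Proof. by exists 'X_i => t; rewrite mevalXU. Qed.

Lemma polyfun_frac D f : polyfun f -> fracfun D f.
Proof.
by move=> [p pE]; exists p, 1 => t _; rewrite meval1 oner_neq0 divr1 pE.
Qed.

Lemma fracfun_alg D : function_algebra (fracfun D).
Proof.
split=> [c|f g [p [q fE]] [r [s gE]]|f g [p [q fE]] [r [s gE]]].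
- by apply: polyfun_frac; apply: (alg_cst polyfun_alg).
- exists (p * s + r * q), (q * s) => t Dt.
  have [q0 ->] := fE t Dt; have [s0 ->] := gE t Dt.
  by rewrite mevalD !mevalM mulf_neq0 // addf_div.
- exists (p * r), (q * s) => t Dt.
  have [q0 ->] := fE t Dt; have [s0 ->] := gE t Dt.
  by rewrite !mevalM mulf_neq0 // mulf_div.
Qed.

Lemma fracfun_div (D : set T) f g :
  (forall t, D t -> g t != 0) -> fracfun D f -> fracfun D g ->
  fracfun D (fun t => f t / g t).
Proof.
move=> g0 fD [r [s gE]]; apply: (alg_mul (fracfun_alg D)) => //.
exists s, r => t Dt; have [s0 gt] := gE t Dt.
have r0 : r.@[x t] != 0.
  by have := g0 t Dt; rewrite gt mulf_eq0 negb_or => /andP[].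
by rewrite r0 gt invf_div.
Qed.

End RationalFunctions.

Section MatrixCoordinates.
Variables (K : fieldType) (n : nat).

Lemma polyfun_mxvec :
  alg_mx (polyfun (fun (A : 'M[K]_n) k => mxvec A 0 k)) id.
Proof.
move=> i j; have := polyfun_coord
  (fun (A : 'M[K]_n) k => mxvec A 0 k) (mxvec_index i j).
by congr polyfun; apply/funext => A; apply: mxvecE.
Qed.

Lemma alg_mxvec (T : Type) (S : (T -> K) -> Prop) (A : T -> 'M[K]_n) k :
  alg_mx S A -> S (fun t => mxvec (A t) 0 k).
Proof.
case/mxvec_indexP: k => i j /(_ i j); congr S.
by apply/funext => t; rewrite mxvecE.
Qed.

End MatrixCoordinates.

(** * Affine spaces *)

Section Affine.
Variables (K : fieldType) (T : Type) (m : nat) (x : T -> 'I_m -> K).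

Lemma affine_regular_open U g :
  regular (affine_space x) U g -> isopen (affine_space x) U.
Proof. by case. Qed.

(** The union of two zero loci is cut out by the products of the equations. *)
Lemma affine_open_setI U V : isopen (affine_space x) U ->
  isopen (affine_space x) V -> isopen (affine_space x) (U `&` V).
Proof.
move=> [S US] [S' VS].
exists [set r | exists p q, [/\ S p, S' q & r = p * q]].
apply/predeqP => t; split=> [nUV r [p [q [Sp Sq ->]]]|tz [Ut Vt]].
  rewrite mevalM; have [Ut|nUt] := pselect (U t).
    have : (~` V) t by move=> Vt; apply: nUV.
    by rewrite VS => /(_ q Sq) ->; rewrite mulr0.
  by have : (~` U) t by []; rewrite US => /(_ p Sp) ->; rewrite mul0r.
have [p Sp p0] : exists2 p, S p & p.@[x t] != 0.
  apply: contrapT => nex; have : zero_locus x S t; last by rewrite -US; apply.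
  move=> p Sp; apply/eqP; apply: contrapT => /negP p0; apply: nex; by exists p.
have [q Sq q0] : exists2 q, S' q & q.@[x t] != 0.
  apply: contrapT => nex; have : zero_locus x S' t; last by rewrite -VS; apply.
  move=> q Sq; apply/eqP; apply: contrapT => /negP q0; apply: nex; by exists q.
have /(_ _ (ex_intro _ p (ex_intro _ q (And3 Sp Sq erefl)))) := tz.
by move/eqP; rewrite mevalM mulf_eq0 (negPf p0) (negPf q0).
Qed.

Lemma affine_regular_setI U V g : isopen (affine_space x) V ->
  regular (affine_space x) U g -> regular (affine_space x) (U `&` V) g.
Proof.
move=> oV [oU rg]; split; first exact: affine_open_setI.
move=> t [Ut Vt]; have [W [p [q [oW Wt WU gE]]]] := rg t Ut.
exists (W `&` V), p, q; split=> //; first exact: affine_open_setI.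
  by move=> u [/WU].
by move=> u [Wu _]; apply: gE.
Qed.

Variables (T' : Type) (m' : nat) (y : T' -> 'I_m' -> K).

(** On the locus where [d] does not vanish, pulling a polynomial back along [f]
    gives a fraction, and multiplying its numerator by [d] turns vanishing there
    into vanishing outside a subset of the locus. *)
Lemma affine_morphism_on (d : T -> K) (f : T -> T') :
  polyfun x d ->
  (forall i, fracfun x [set t | d t != 0] (fun t => y (f t) i)) ->
  morphism_on (affine_space x) [set t | d t != 0] (affine_space y) f.
Proof.
set D := [set t | d t != 0] => -[pd dE] fD.
have pull (p : {mpoly K[m']}) : fracfun x D (fun t => p.@[y (f t)]).
  exact: (alg_meval (fracfun_alg x D)).
have op U : isopen (affine_space y) U ->
    isopen (affine_space x) (D `&` f @^-1` U).
  move=> [S US]; exists [set r | exists p P Q, [/\ S p,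
    forall t, D t -> Q.@[x t] != 0 /\ p.@[y (f t)] = P.@[x t] / Q.@[x t] &
    r = pd * P]].
  apply/predeqP => t; split=> [nDU r [p [P [Q [Sp pE ->]]]]|tz [Dt Ut]].
    rewrite mevalM -dE; have [->|dt] := eqVneq (d t) 0; first by rewrite mul0r.
    have : (~` U) (f t) by move=> Ut; apply: nDU.
    rewrite US => /(_ p Sp) pft; have [q0] := pE t dt.
    move/eqP; rewrite pft eq_sym mulf_eq0 invr_eq0 (negPf q0) orbF => /eqP ->.
    by rewrite mulr0.
  suff : zero_locus y S (f t) by rewrite -US; apply.
  move=> p Sp; have [P [Q pE]] := pull p; have [q0 ->] := pE t Dt.
  have : (pd * P).@[x t] = 0 by apply: tz; exists p, P, Q.
  by move/eqP; rewrite mevalM -dE mulf_eq0 (negPf Dt) => /eqP ->; rewrite mul0r.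
split=> // U g [oU rg]; split; first exact: op.
move=> t [Dt Ut]; have [V [p [q [oV Vt VU gE]]]] := rg _ Ut.
have [P [Q PQ]] : fracfun x (D `&` f @^-1` V)
    (fun t => p.@[y (f t)] / q.@[y (f t)]).
  have sub h : fracfun x D h -> fracfun x (D `&` f @^-1` V) h.
    by move=> [P [Q hE]]; exists P, Q => u [Du _]; apply: hE.
  by apply: fracfun_div; [move=> u [_ Vu]; case: (gE _ Vu) | exact/sub/pull..].
exists (D `&` f @^-1` V), P, Q; split=> //.
- exact: op.
- by move=> u [Du /VU].
- move=> u DVu; have [Q0 <-] := PQ u DVu; split=> //=.
  by case: DVu => _ Vu; case: (gE _ Vu).
Qed.

Lemma affine_polynomial_morphism (f : T -> T') :
  (forall i, polyfun x (fun t => y (f t) i)) ->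
  morphism_on (affine_space x) setT (affine_space y) f.
Proof.
move=> fP; have -> : setT = [set t : T | (1 : K) != 0].
  by apply/predeqP => t; split=> // _; rewrite /= oner_neq0.
apply: (affine_morphism_on (d := fun=> 1)).
  exact: (alg_cst (polyfun_alg x)).
by move=> i; apply: polyfun_frac.
Qed.

End Affine.

(** * Triangular and permutation matrices *)

Section Triangular.
Variables (K : fieldType) (n : nat).
Implicit Types (A B b L : 'M[K]_n) (w : 'S_n).

Lemma upper_triangularP A :
  reflect (forall i j : 'I_n, (j < i)%N -> A i j = 0) (upper_triangular A).
Proof.
apply: (iffP is_trig_mxP) => tA i j ij; last by rewrite mxE tA.
by have := tA j i ij; rewrite mxE.
Qed.

Lemma upper_triangular_det A : upper_triangular A -> \det A = \prod_i A i i.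
Proof.
by move=> tA; rewrite -det_tr det_trig //; apply: eq_bigr => i _; rewrite mxE.
Qed.

Lemma borel_diag b i : borel b -> b i i != 0.
Proof.
move=> [ub tb]; move: ub; rewrite unitmxE unitfE upper_triangular_det //.
by move=> /prodf_neq0/(_ i isT).
Qed.

Lemma borel_opp_diag b i : borel_opp b -> b i i != 0.
Proof.
move=> [ub tb]; move: ub; rewrite unitmxE unitfE det_trig //.
by move=> /prodf_neq0/(_ i isT).
Qed.

Lemma borelM A B : borel A -> borel B -> borel (A *m B).
Proof.
move=> [uA /upper_triangularP tA] [uB /upper_triangularP tB].
split; first by rewrite unitmx_mul uA.
apply/upper_triangularP => i j ji; rewrite mxE big1 // => k _.
have [ki|ik] := ltnP k i; first by rewrite tA // mul0r.
by rewrite tB ?mulr0 // (leq_trans ji).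
Qed.

(** B is the stabiliser of the standard flag, and stabilisers contain inverses. *)
Lemma borelV b : borel b -> borel (invmx b).
Proof.
move=> bb; have [ub _] := bb.
have : flag_of 1%:M = flag_of b.
  by apply/flag_of_eqP; rewrite ?unitmx1 //; exists b; rewrite ?mul1mx.
move=> /esym/flag_of_eqP; rewrite unitmx1 => /(_ ub isT)[c bc].
by move/(congr1 (mulmx (invmx b))); rewrite mulKmx // mulmx1 => ->.
Qed.

Lemma pmat1 : pmat K (1%g : 'S_n) = 1%:M.
Proof. by apply/matrixP => i j; rewrite !mxE perm1. Qed.

Lemma pmat_mulV w : pmat K w *m pmat K w^-1%g = 1%:M.
Proof. by rewrite -pmatM /perm_comp mulVg pmat1. Qed.

Lemma pmat_Vmul w : pmat K w^-1%g *m pmat K w = 1%:M.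
Proof. by rewrite -pmatM /perm_comp mulgV pmat1. Qed.

Lemma pmat_unit w : pmat K w \in unitmx.
Proof. by have [] := mulmx1_unit (pmat_mulV w). Qed.

Lemma pmat_mull w A i j : (pmat K w *m A) i j = A (w^-1%g i) j.
Proof.
rewrite mxE (bigD1 (w^-1%g i)) //= mxE permKV eqxx mul1r big1 ?addr0 // => k kw.
rewrite mxE; have -> : (i == w k) = false; last by rewrite mul0r.
by apply: contraNF kw => /eqP ->; rewrite permK.
Qed.

Lemma pmat_mulr w A i j : (A *m pmat K w) i j = A i (w j).
Proof.
rewrite mxE (bigD1 (w j)) //= mxE eqxx mulr1 big1 ?addr0 // => k kw.
by rewrite mxE (negPf kw) mulr0.
Qed.

End Triangular.

Section LowerUnipotent.
Variables (K : fieldType) (n : nat).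
Implicit Types M : 'M[K]_n.

Lemma trig_mx_diagM (A B : 'M[K]_n) i : is_trig_mx A -> is_trig_mx B ->
  (A *m B) i i = A i i * B i i.
Proof.
move=> /is_trig_mxP tA /is_trig_mxP tB.
rewrite mxE (bigD1 i) //= big1 ?addr0 // => k ki.
case: (ltngtP k i) => [lt|gt|/val_inj e]; last by rewrite e eqxx in ki.
  by rewrite tB ?mulr0.
by rewrite tA ?mul0r.
Qed.

Lemma lower_unip_inv M :
  M \in unitmx -> is_trig_mx M -> (forall i, M i i = 1) ->
  is_trig_mx (invmx M) /\ forall i, invmx M i i = 1.
Proof.
move=> uM tM M1.
have [_ tV] : borel (invmx M^T).
  by apply: borelV; split; rewrite ?unitmx_tr // /upper_triangular trmxK.
have tV' : is_trig_mx (invmx M).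
  by move: tV; rewrite /upper_triangular trmx_inv trmxK.
split=> // i; have := trig_mx_diagM i tM tV'.
by rewrite mulmxV // mxE eqxx M1 mul1r => <-.
Qed.

End LowerUnipotent.

(** * Flags and translation by the longest element *)

Section LongestElement.
Variables (K : fieldType) (n : nat).
Implicit Types (A b : 'M[K]_n) (w : 'S_n).

Lemma w0K : involutive (w0 n).
Proof. by move=> i; rewrite !permE rev_ordK. Qed.

Lemma w0V : (w0 n)^-1%g = w0 n.
Proof.
by apply/permP => i; apply: (@perm_inj _ (w0 n)); rewrite permKV w0K.
Qed.

Lemma w0_lt (i j : 'I_n) : (i < j)%N -> (w0 n j < w0 n i)%N.
Proof. by move=> ij; rewrite !permE /=; have := ltn_ord j; move: ij; lia. Qed.

Lemma pmat_w0K : pmat K (w0 n) *m pmat K (w0 n) = 1%:M.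
Proof. by rewrite -{2}w0V pmat_mulV. Qed.

Lemma w0_conjE A i j :
  (pmat K (w0 n) *m A *m pmat K (w0 n)) i j = A (w0 n i) (w0 n j).
Proof. by rewrite pmat_mulr pmat_mull w0V. Qed.

Lemma w0_conj_unit A : A \in unitmx ->
  pmat K (w0 n) *m A *m pmat K (w0 n) \in unitmx.
Proof. by move=> uA; rewrite !unitmx_mul uA pmat_unit. Qed.

Lemma borel_w0 b : borel_opp b -> borel (pmat K (w0 n) *m b *m pmat K (w0 n)).
Proof.
move=> [ub /is_trig_mxP tb]; split; first exact: w0_conj_unit.
by apply/upper_triangularP => i j ji; rewrite w0_conjE tb // w0_lt.
Qed.

Lemma borel_opp_w0 b :
  borel b -> borel_opp (pmat K (w0 n) *m b *m pmat K (w0 n)).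
Proof.
move=> [ub /upper_triangularP tb]; split; first exact: w0_conj_unit.
by apply/is_trig_mxP => i j ij; rewrite w0_conjE tb // w0_lt.
Qed.

Lemma flag_of_mulB A b :
  A \in unitmx -> borel b -> flag_of (A *m b) = flag_of A.
Proof.
move=> uA bb; have uAb : A *m b \in unitmx by rewrite unitmx_mul uA; case: bb.
by apply/esym/(flag_of_eqP uA uAb); exists b.
Qed.

Lemma flag_of_mull P A A' : P \in unitmx -> A \in unitmx -> A' \in unitmx ->
  flag_of A = flag_of A' -> flag_of (P *m A) = flag_of (P *m A').
Proof.
move=> uP uA uA' /(flag_of_eqP uA uA')[b bb ->].
by rewrite mulmxA (flag_of_mulB _ bb) // unitmx_mul uP.
Qed.

Lemma schubert_w0 w A : A \in unitmx -> schubert w (flag_of A) ->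
  schubert_opp (perm_comp (w0 n) w) (flag_of (pmat K (w0 n) *m A)).
Proof.
move=> uA [b [c [bb bc AE]]].
exists (pmat K (w0 n) *m b *m pmat K (w0 n)), c; split=> //.
  exact: borel_opp_w0.
rewrite (flag_of_mull (pmat_unit _ _) uA _ AE); last first.
  by case: bb bc => ub _ [uc _]; rewrite !unitmx_mul ub uc pmat_unit.
rewrite pmatM !mulmxA -[_ *m pmat K (w0 n) *m pmat K (w0 n)]mulmxA.
by rewrite pmat_w0K mulmx1.
Qed.

Lemma schubert_opp_w0 w A : A \in unitmx -> schubert_opp w (flag_of A) ->
  schubert (perm_comp (w0 n) w) (flag_of (pmat K (w0 n) *m A)).
Proof.
move=> uA [b [c [bb bc AE]]].
exists (pmat K (w0 n) *m b *m pmat K (w0 n)), c; split=> //.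
  exact: borel_w0.
rewrite (flag_of_mull (pmat_unit _ _) uA _ AE); last first.
  by case: bb bc => ub _ [uc _]; rewrite !unitmx_mul ub uc pmat_unit.
rewrite pmatM !mulmxA -[_ *m pmat K (w0 n) *m pmat K (w0 n)]mulmxA.
by rewrite pmat_w0K mulmx1.
Qed.

Lemma perm_compA (u v w : 'S_n) :
  perm_comp u (perm_comp v w) = perm_comp (perm_comp u v) w.
Proof. by rewrite /perm_comp mulgA. Qed.

Lemma perm_comp_w0K w : perm_comp (w0 n) (perm_comp (w0 n) w) = w.
Proof. by apply/permP => i; rewrite !perm_compE w0K. Qed.

(** Translation by w_0 exchanges B and B_-, so it exchanges the two families of
    cells. *)
Lemma w0_translate_cells u v :
  [set flag_of (pmat K (w0 n) *m A) | A in
    [set A | A \in unitmx /\ (schubert u `&` schubert_opp v) (flag_of A)]] =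
  schubert_opp (perm_comp (w0 n) u) `&` schubert (perm_comp (w0 n) v)
    :> set (flag K n).
Proof.
apply/predeqP => F; split=> [[A [uA [uF vF]] <-]|[oF sF]].
  by split; [apply: schubert_w0 | apply: schubert_opp_w0].
have [C uC FC] : exists2 C, C \in unitmx & F = flag_of C.
  have [b [c [[ub _] [uc _] ->]]] := sF.
  exists (b *m pmat K (perm_comp (w0 n) v) *m c) => //.
  by rewrite !unitmx_mul ub uc pmat_unit.
exists (pmat K (w0 n) *m C); last by rewrite mulmxA pmat_w0K mul1mx.
split; first by rewrite unitmx_mul uC pmat_unit.
split.
  by rewrite -[u]perm_comp_w0K; apply: schubert_opp_w0; rewrite -?FC.
by rewrite -[v]perm_comp_w0K; apply: schubert_w0; rewrite -?FC.
Qed.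

End LongestElement.

(** * Coordinates on the big cell *)

Section BigCell.
Variables (K : fieldType) (n : nat).
Implicit Types (A B b L : 'M[K]_n) (i j r c : 'I_n).

(** Its determinant is the minor of [A] on the rows 0, ..., j-1, i and the columns
    0, ..., j, padded with unit vectors so that the size does not depend on [j]. *)
Definition minor_mx i j A : 'M[K]_n :=
  \matrix_(r, c) if (c <= j)%N then A (if r == j then i else r) c
                 else (r == c)%:R.

Definition corner_mx j b : 'M[K]_n :=
  \matrix_(r, c) if (c <= j)%N then b r c else (r == c)%:R.

(** These minors only involve initial sets of columns, so right multiplication by
    an upper triangular matrix multiplies them by a factor that depends on [j] but
    not on [i]. *)
Lemma minor_mxM i j A b : upper_triangular b ->
  minor_mx i j (A *m b) = minor_mx i j A *m corner_mx j b.
Proof.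
move=> /upper_triangularP tb; apply/matrixP => r c; rewrite !mxE.
have [cj|jc] := leqP c j.
  apply: eq_bigr => k _; rewrite !mxE cj; have [kj|jk] := leqP k j => //.
  by rewrite tb ?mulr0 // (leq_ltn_trans cj).
rewrite (bigD1 c) //= !mxE leqNgt jc /= eqxx mulr1 big1 ?addr0 // => k kc.
by rewrite [X in _ * X]mxE leqNgt jc /= (negPf kc) mulr0.
Qed.

Lemma det_corner_neq0 j b : borel b -> \det (corner_mx j b) != 0.
Proof.
move=> bb; have [_ /upper_triangularP tb] := bb.
rewrite upper_triangular_det; last first.
  apply/upper_triangularP => r c cr; rewrite mxE.
  case: leqP => _; first exact: tb.
  by rewrite -val_eqE gtn_eqF.
apply/prodf_neq0 => r _; rewrite mxE; case: leqP => _; first exact: borel_diag.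
by rewrite eqxx oner_neq0.
Qed.

Lemma det_minor_unip i j L : is_trig_mx L -> (forall r, L r r = 1) ->
  \det (minor_mx i j L) = L i j.
Proof.
move=> /is_trig_mxP tL L1; rewrite det_trig; last first.
  apply/is_trig_mxP => r c rc; rewrite mxE; case: leqP => [cj|_].
    by rewrite -val_eqE ltn_eqF ?tL // (leq_trans rc).
  by rewrite -val_eqE ltn_eqF.
rewrite (bigD1 j) //= mxE leqnn eqxx big1 ?mulr1 // => r rj.
by rewrite mxE (negPf rj) L1 eqxx; case: leqP.
Qed.

(** The product of the leading principal minors, whose nonvanishing defines the
    big cell U_- B. *)
Definition big_cell_den A : K := \prod_j \det (minor_mx j j A).

(** Gauss's formulas: on U_- B this is the factor in U_-, by [lower_factor_borel]
    and [lower_factor_unip]. *)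
Definition lower_factor A : 'M[K]_n :=
  \matrix_(i, j) (\det (minor_mx i j A) / \det (minor_mx j j A)).

Lemma big_cell_den_borel A b : borel b ->
  (big_cell_den (A *m b) != 0) = (big_cell_den A != 0).
Proof.
move=> bb; have [_ tb] := bb; rewrite /big_cell_den.
under eq_bigr do rewrite minor_mxM // det_mulmx.
rewrite big_split /= mulf_eq0 negb_or andbC.
have -> : \prod_j \det (corner_mx j b) != 0 => //.
by apply/prodf_neq0 => j _; apply: det_corner_neq0.
Qed.

Lemma lower_factor_borel A b :
  borel b -> lower_factor (A *m b) = lower_factor A.
Proof.
move=> bb; have [_ tb] := bb; apply/matrixP => i j; rewrite !mxE !minor_mxM //.
by rewrite !det_mulmx -mulf_div divff ?mulr1 // det_corner_neq0.
Qed.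

Lemma big_cell_den_unip L : is_trig_mx L -> (forall r, L r r = 1) ->
  big_cell_den L = 1.
Proof. by move=> tL L1; apply: big1 => j _; rewrite det_minor_unip. Qed.

Lemma lower_factor_unip L : is_trig_mx L -> (forall r, L r r = 1) ->
  lower_factor L = L.
Proof.
by move=> tL L1; apply/matrixP => i j; rewrite mxE !det_minor_unip // L1 divr1.
Qed.

Variables (T : Type) (A : T -> 'M[K]_n).

Lemma alg_minor (S : (T -> K) -> Prop) i j : function_algebra S ->
  alg_mx S A -> S (fun t => \det (minor_mx i j (A t))).
Proof.
move=> S_alg SA; apply: alg_det => // r c; under eq_fun do rewrite mxE.
by case: (c <= j)%N; [apply: SA | apply: alg_cst].
Qed.

Lemma polyfun_big_cell_den m (x : T -> 'I_m -> K) :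
  alg_mx (polyfun x) A -> polyfun x (fun t => big_cell_den (A t)).
Proof.
move=> PA; apply: (alg_prod (polyfun_alg x)) => j.
exact: (alg_minor j j (polyfun_alg x)).
Qed.

Lemma fracfun_lower_factor m (x : T -> 'I_m -> K) (D : set T) :
  (forall t, D t -> big_cell_den (A t) != 0) ->
  alg_mx (polyfun x) A -> alg_mx (fracfun x D) (fun t => lower_factor (A t)).
Proof.
move=> D0 PA i j; under eq_fun do rewrite mxE.
apply: fracfun_div => [t /D0/prodf_neq0/(_ j isT) //||];
  exact/polyfun_frac/(alg_minor _ _ (polyfun_alg x) PA).
Qed.

End BigCell.

(** * Reduced words *)

Section ReducedWords.
Variable n : nat.
Implicit Types (a : 'I_n.-1) (b c : seq 'I_n.-1) (i j : 'I_n).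

Lemma strand_lo_hi a : (strand_lo a < strand_hi a)%N.
Proof. exact: ltnSn. Qed.

Lemma strand_neq a : (strand_lo a == strand_hi a) = false.
Proof. by rewrite -val_eqE /= ltn_eqF. Qed.

Lemma simple_refl_lt a i j : (i < j)%N ->
  ~~ ((i == strand_lo a) && (j == strand_hi a)) ->
  (simple_refl a i < simple_refl a j)%N.
Proof.
have val_refl (k : 'I_n) : simple_refl a k = (if k == a :> nat then a.+1
    else if k == a.+1 :> nat then nat_of_ord a else nat_of_ord k) :> nat.
  rewrite /simple_refl; case: tpermP => [->|->|/eqP + /eqP] /=.
  - by rewrite eqxx.
  - by rewrite eqxx gtn_eqF.
  - by rewrite -!val_eqE /= => /negPf-> /negPf->.
by rewrite !val_refl -!val_eqE /=; do !case: eqP => ?; lia.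
Qed.

Lemma coxeter_cons a b :
  coxeter (a :: b) = perm_comp (simple_refl a) (coxeter b).
Proof. by []. Qed.

Lemma coxeter_consV a b i :
  (coxeter (a :: b))^-1%g i = (coxeter b)^-1%g (simple_refl a i).
Proof. by rewrite coxeter_cons invMg permM tpermV. Qed.

(** Going through the word from the left, the pair of positions is moved by each
    letter and keeps its order until some letter swaps it, which happens as the
    inverse of the product inverts the pair; that letter is the one to delete. *)
Lemma strong_exchange b i j : (i < j)%N ->
  ((coxeter b)^-1%g j < (coxeter b)^-1%g i)%N ->
  exists2 c, (size c < size b)%N &
    coxeter c = perm_comp (tperm i j) (coxeter b).
Proof.
elim: b i j => [|a b IH] i j ij; first by rewrite invg1 !perm1 ltnNge ltnW.
rewrite !coxeter_consV => inv.
have [/andP[/eqP -> /eqP ->]|aij] :=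
  boolP ((i == strand_lo a) && (j == strand_hi a)).
  exists b => //; rewrite coxeter_cons /perm_comp /simple_refl -mulgA.
  by rewrite -{2}(tpermV (strand_lo a)) mulgV mulg1.
have [c cb cE] := IH _ _ (simple_refl_lt ij aij) inv.
exists (a :: c); rewrite ?ltnS // !coxeter_cons cE /perm_comp.
rewrite -tpermJ conjgE {1}/simple_refl tpermV -!mulgA.
by rewrite -{2}[simple_refl a]tpermV mulgV mulg1.
Qed.

(** If w is the projection of the tail, the inequality says that the root
    w^-1(alpha_a) is positive. *)
Lemma reduced_cons a b : reduced (a :: b) ->
  reduced b /\
  ((coxeter b)^-1%g (strand_lo a) < (coxeter b)^-1%g (strand_hi a))%N.
Proof.
move=> red; split=> [c cb|].
  by have := red (a :: c); rewrite !coxeter_cons cb => /(_ erefl).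
rewrite ltnNge leq_eqVlt; apply/negP => /orP[/eqP/val_inj/perm_inj/eqP|inv].
  by rewrite eq_sym strand_neq.
have [c cb cE] := strong_exchange (strand_lo_hi a) inv.
by have := red c cE; rewrite leqNgt /= ltnS ltnW.
Qed.

End ReducedWords.

(** * Braid matrices *)

Section BraidMatrices.
Variables (K : fieldType) (n : nat).
Implicit Types (a : 'I_n.-1) (z : K) (A b M : 'M[K]_n) (i j r c : 'I_n).
Implicit Types (s : seq ('I_n.-1 * K)) (w : 'S_n).

Definition transvection i j z : 'M[K]_n := 1%:M + z *: delta_mx i j.

Lemma transvectionE i j z r c :
  transvection i j z r c = (r == c)%:R + z * ((r == i) && (c == j))%:R.
Proof. by rewrite !mxE. Qed.

Lemma transvection_mull i j z A r c :
  (transvection i j z *m A) r c = A r c + (r == i)%:R * z * A j c.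
Proof.
rewrite mulmxDl mul1mx -scalemxAl 2!mxE; congr (_ + _).
rewrite [X in _ * X]mxE (bigD1 j) //= mxE eqxx andbT big1 => [|k kj].
  by rewrite addr0 mulrCA mulrA.
by rewrite mxE (negPf kj) andbF mul0r.
Qed.

Lemma transvection_mulN i j z : i != j ->
  transvection i j z *m transvection i j (- z) = 1%:M.
Proof.
move=> ij; apply/matrixP => r c; rewrite transvection_mull !transvectionE mxE.
rewrite (eq_sym j i) (negPf ij) /= mulr0 addr0 [j == c]eq_sym.
case: (r == i) (c == j) => [] [];
  by rewrite /= ?mulr1 ?mulr0 ?mul1r ?mul0r ?addr0 // addrNK.
Qed.

Lemma Bgen_lower a z :
  Bgen a z =
  transvection (strand_hi a) (strand_lo a) z *m pmat K (simple_refl a).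
Proof.
apply/matrixP => r c; rewrite pmat_mulr transvectionE mxE /simple_refl.
have lh := strand_neq a; have hl : (strand_hi a == strand_lo a) = false.
  by rewrite eq_sym.
have rlh : (r == strand_lo a) && (r == strand_hi a) = false.
  by apply/andP => -[/eqP -> ]; rewrite lh.
case: tpermP => [->|->|/eqP/negPf cl /eqP/negPf ch].
- rewrite eqxx lh hl !andbF !andbT.
  case: (r == strand_lo a) rlh => /= [->|_]; rewrite mulr0 addr0 //.
  by case: ifP.
- rewrite hl !andbF !eqxx !andbT; case: (r == strand_lo a) rlh => /= [->|_].
    by rewrite mulr0 addr0.
  by case: (r == strand_hi a); rewrite /= ?mulr1 ?mulr0 ?addr0 ?add0r.
- by rewrite cl ch !andbF mulr0 addr0.
Qed.

Lemma Bgen_upper a z :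
  Bgen a z =
  pmat K (simple_refl a) *m transvection (strand_lo a) (strand_hi a) z.
Proof.
apply/matrixP => r c.
rewrite Bgen_lower pmat_mulr pmat_mull !transvectionE tpermV.
have can i j : (simple_refl a i == j) = (i == simple_refl a j).
  exact: (can2_eq (tpermK _ _) (tpermK _ _)).
by rewrite !can /simple_refl tpermL.
Qed.

(** Membership in the group U_- meet w U w^-1: the pairs below the diagonal in
    which an entry is allowed are the root subgroups common to U_- and w U w^-1. *)
Definition unip_supp w M := forall i j,
  ~~ ((j < i) && (w^-1%g i < w^-1%g j))%N -> M i j = (i == j)%:R.

Definition word_mx s : 'M[K]_n := \prod_(p <- s) Bgen p.1 p.2.

Definition word_unip s : 'M[K]_n :=
  word_mx s *m pmat K (coxeter (unzip1 s))^-1%g.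

Lemma word_mx_cons a z s : word_mx ((a, z) :: s) = Bgen a z *m word_mx s.
Proof. by rewrite /word_mx big_cons. Qed.

Lemma word_mxE s : word_mx s = word_unip s *m pmat K (coxeter (unzip1 s)).
Proof. by rewrite -mulmxA pmat_Vmul mulmx1. Qed.

Lemma word_unip_cons a z s : word_unip ((a, z) :: s) =
  transvection (strand_hi a) (strand_lo a) z *m
  (pmat K (simple_refl a) *m word_unip s *m pmat K (simple_refl a)).
Proof.
rewrite /word_unip word_mx_cons Bgen_lower coxeter_cons /perm_comp invMg tpermV.
by rewrite -[(_ * _)%g]/(perm_comp _ _) pmatM !mulmxA.
Qed.

(** Prepending a letter a conjugates by s_a and adds the negative simple root of a.
    Conjugation by s_a keeps U_- except for that very root, which is absent from
    the matrix of the tail since a reduced word makes w^-1(alpha_a) positive. *)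
Lemma word_unip_supp s : reduced (unzip1 s) ->
  unip_supp (coxeter (unzip1 s)) (word_unip s).
Proof.
elim: s => [_ i j _|[a z] s IH /= red i j].
  by rewrite /word_unip /word_mx big_nil invg1 pmat1 mul1mx mxE.
have [reds lohi] := reduced_cons red; move/IH: reds => {}IH.
rewrite !coxeter_consV word_unip_cons transvection_mull.
rewrite !pmat_mulr !pmat_mull tpermV.
rewrite -/(simple_refl a); set t := simple_refl a.
set v := (coxeter _)^-1%g in IH lohi *.
have tlo : t (strand_lo a) = strand_hi a by rewrite /t /simple_refl tpermL.
have thi : t (strand_hi a) = strand_lo a by rewrite /t /simple_refl tpermR.
have conj (k l : 'I_n) : ~~ ((l < k) && (v (t k) < v (t l)))%N ->
    word_unip s (t k) (t l) = (k == l)%:R.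
  move=> kl; rewrite -(inj_eq (@perm_inj _ t)); apply: IH.
  apply: contra kl => /andP[tlk vkl]; rewrite vkl andbT ltnNge leq_eqVlt.
  apply/negP => /orP[/eqP/val_inj kl|kl]; first by rewrite kl ltnn in tlk.
  have [/andP[/eqP kE /eqP lE]|nkl] :=
    boolP ((k == strand_lo a) && (l == strand_hi a)).
    by move: vkl; rewrite kE lE tlo thi ltnNge ltnW.
  by move: tlk; rewrite ltnNge ltnW // simple_refl_lt.
move=> nij; rewrite conj //; have [ih|ih] := eqVneq i (strand_hi a); last first.
  by rewrite mul0r mul0r addr0.
rewrite conj; last first.
  apply: contra nij => /andP[jlo vj].
  rewrite ih thi (ltn_trans jlo) ?strand_lo_hi //=.
  by rewrite (ltn_trans lohi) // -tlo.
suff -> : (strand_lo a == j) = false by rewrite mulr0 addr0.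
by apply: contraNF nij => /eqP <-; rewrite ih thi tlo lohi strand_lo_hi.
Qed.

Lemma unip_supp_trig w M : unip_supp w M -> is_trig_mx M /\ forall i, M i i = 1.
Proof.
move=> sM; split=> [|i]; last by rewrite sM ?eqxx // ltnn.
apply/is_trig_mxP => i j ij; rewrite sM; last by rewrite ltnNge ltnW.
by rewrite -val_eqE ltn_eqF.
Qed.

Lemma unip_supp_det w M : unip_supp w M -> \det M = 1.
Proof.
by move=> /unip_supp_trig[tM M1]; rewrite det_trig // big1.
Qed.

Lemma unip_supp_unit w M : unip_supp w M -> M \in unitmx.
Proof. by move=> sM; rewrite unitmxE (unip_supp_det sM) unitr1. Qed.

Lemma unip_supp_conj w M : unip_supp w M ->
  upper_triangular (pmat K w^-1%g *m M *m pmat K w) /\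
  forall i, (pmat K w^-1%g *m M *m pmat K w) i i = 1.
Proof.
move=> sM; split=> [|i]; last first.
  by rewrite pmat_mulr pmat_mull invgK sM ?eqxx // ltnn.
apply/upper_triangularP => i j ji; rewrite pmat_mulr pmat_mull invgK sM.
  by rewrite (inj_eq perm_inj) -val_eqE gtn_eqF.
by rewrite !permK negb_and -leqNgt -[X in _ || X]leqNgt (ltnW ji) orbT.
Qed.

(** Each letter brings a simple reflection, which moves a single entry of an upper
    triangular matrix below the diagonal, and a free parameter, which can be chosen
    to clear that entry beforehand. *)
Lemma word_mx_borel (u : seq 'I_n.-1) b : borel b ->
  exists2 s, unzip1 s = u & borel (word_mx s *m b *m pmat K (coxeter u)^-1%g).
Proof.
elim: u b => [|a u IH] b bb.
  exists [::] => //; rewrite /word_mx big_nil mul1mx invg1 pmat1 mulmx1.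
  exact: bb.
have [s su] := IH b bb; set c := _ *m _ => bc.
pose z := - (c (strand_lo a) (strand_hi a) / c (strand_hi a) (strand_hi a)).
exists ((a, z) :: s); first by rewrite /= su.
have -> : word_mx ((a, z) :: s) *m b *m pmat K (coxeter (a :: u))^-1%g =
    Bgen a z *m c *m pmat K (simple_refl a).
  rewrite word_mx_cons coxeter_cons /perm_comp invMg tpermV.
  by rewrite -[(_ * _)%g]/(perm_comp _ _) pmatM !mulmxA.
have [uc /upper_triangularP tc] := bc.
have chh := borel_diag (strand_hi a) bc.
split.
  rewrite 2!unitmx_mul uc !pmat_unit !andbT Bgen_upper unitmx_mul pmat_unit.
  have lh : strand_lo a != strand_hi a by rewrite strand_neq.
  by case: (mulmx1_unit (transvection_mulN z lh)).
apply/upper_triangularP => i j ji.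
rewrite Bgen_upper pmat_mulr -mulmxA pmat_mull tpermV transvection_mull.
rewrite -/(simple_refl a).
have [/andP[/eqP -> /eqP ->]|nij] :=
    boolP ((j == strand_lo a) && (i == strand_hi a)).
  by rewrite /simple_refl tpermL tpermR eqxx mul1r /z mulNr divfK // subrr.
have tji := simple_refl_lt ji nij; rewrite tc // add0r.
have [ilo|_] := eqVneq (simple_refl a i) (strand_lo a); last by rewrite !mul0r.
by rewrite tc ?mulr0 // (ltn_trans _ (strand_lo_hi a)) // -ilo.
Qed.

(** The mirror image of the previous lemma, with the letters taken from the other
    side and the entries below the diagonal cleared. *)
Lemma word_mx_borel_opp (u : seq 'I_n.-1) b : borel_opp b ->
  exists2 s, unzip1 s = u &
    exists2 c, borel_opp c & b *m pmat K (coxeter u) = word_mx s *m c.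
Proof.
elim: u b => [|a u IH] b bb.
  exists [::] => //; exists b => //.
  by rewrite /word_mx big_nil mul1mx pmat1 mulmx1.
have [ub /is_trig_mxP tb] := bb.
have bll := borel_opp_diag (strand_lo a) bb.
pose z := b (strand_hi a) (strand_lo a) / b (strand_lo a) (strand_lo a).
pose c := pmat K (simple_refl a) *m
  (transvection (strand_hi a) (strand_lo a) (- z) *m b) *m pmat K (simple_refl a).
have hl : strand_hi a != strand_lo a by rewrite eq_sym strand_neq.
have bc : borel_opp c.
  split.
    rewrite !unitmx_mul ub !pmat_unit !andbT /=.
    by case: (mulmx1_unit (transvection_mulN z hl)).
  apply/is_trig_mxP => i j ij.
  rewrite pmat_mulr pmat_mull tpermV transvection_mull -/(simple_refl a).
  have [/andP[/eqP -> /eqP ->]|nij] :=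
      boolP ((i == strand_lo a) && (j == strand_hi a)).
    by rewrite /simple_refl tpermL tpermR eqxx mul1r /z mulNr divfK // subrr.
  have tij := simple_refl_lt ij nij; rewrite tb // add0r.
  have [ihi|_] := eqVneq (simple_refl a i) (strand_hi a); last first.
    by rewrite !mul0r.
  by rewrite tb ?mulr0 // (ltn_trans (strand_lo_hi a)) // -ihi.
have [s su [d bd cE]] := IH c bc.
exists ((a, z) :: s); first by rewrite /= su.
exists d => //.
rewrite word_mx_cons -mulmxA -cE /c Bgen_lower coxeter_cons pmatM.
have ss : pmat K (simple_refl a) *m pmat K (simple_refl a) = 1%:M.
  by rewrite -{2}[simple_refl a]tpermV pmat_mulV.
rewrite -!mulmxA (mulmxA (pmat K (simple_refl a)) (pmat K _)) ss mul1mx.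
by rewrite (mulmxA (transvection _ _ z)) transvection_mulN // mul1mx.
Qed.

(** In the unipotent matrix of a reduced word, only the first letter contributes
    to the entry of its own simple root, so this entry is its parameter; clearing
    it and undoing the conjugation leaves the matrix of the tail. *)
Fixpoint word_params (u : seq 'I_n.-1) M : seq K :=
  if u is a :: u' then
    M (strand_hi a) (strand_lo a) ::
    word_params u' (pmat K (simple_refl a) *m
      (transvection (strand_hi a) (strand_lo a)
         (- M (strand_hi a) (strand_lo a)) *m M) *m pmat K (simple_refl a))
  else [::].

Lemma word_paramsK s : reduced (unzip1 s) ->
  word_params (unzip1 s) (word_unip s) = unzip2 s.
Proof.
elim: s => [//|[a z] s IH] red /=; have [/= reds lohi] := reduced_cons red.
set N := pmat K (simple_refl a) *m word_unip s *m pmat K (simple_refl a).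
have E : word_unip ((a, z) :: s) =
    transvection (strand_hi a) (strand_lo a) z *m N by apply: word_unip_cons.
have hl : strand_hi a != strand_lo a by rewrite eq_sym strand_neq.
have sM := word_unip_supp reds.
have zE : word_unip ((a, z) :: s) (strand_hi a) (strand_lo a) = z.
  rewrite E transvection_mull !pmat_mulr !pmat_mull tpermV /simple_refl.
  rewrite tpermL tpermR eqxx mul1r !sM ?ltnn // ?eqxx ?mulr1 ?strand_neq ?add0r //.
  by rewrite ltnNge ltnW // strand_lo_hi.
rewrite zE E; congr (_ :: _).
have ss : pmat K (simple_refl a) *m pmat K (simple_refl a) = 1%:M.
  by rewrite -{2}[simple_refl a]tpermV pmat_mulV.
have tt : transvection (strand_hi a) (strand_lo a) (- z) *m
    (transvection (strand_hi a) (strand_lo a) z *m N) = N.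
  by rewrite mulmxA -{2}[z]opprK transvection_mulN // mul1mx.
by rewrite tt /N -!mulmxA ss mulmx1 mulmxA ss mul1mx IH.
Qed.

Lemma alg_word_params (T : Type) (S : (T -> K) -> Prop) u (A : T -> 'M[K]_n) k :
  function_algebra S -> alg_mx S A -> S (fun t => (word_params u (A t))`_k).
Proof.
move=> S_alg; elim: u A k => [|a u IH] A [|k] SA /=; try exact: alg_cst.
  exact: SA.
apply: IH; apply: (alg_mx_mul S_alg _ (alg_mx_cst S_alg _)).
apply: (alg_mx_mul S_alg (alg_mx_cst S_alg _)).
apply: (alg_mx_mul S_alg _ SA) => i j; under eq_fun do rewrite transvectionE.
apply: alg_add => //; first exact: alg_cst.
by apply: alg_mul (alg_opp S_alg (SA _ _)) (alg_cst S_alg _).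
Qed.

End BraidMatrices.

Section Letters.
Variables (K : fieldType) (n m : nat) (b : m.-tuple 'I_n.-1).
Implicit Types (z : 'rV[K]_m).

(** Lists of letters with their parameters support the induction on words; this
    is the passage from a word and a coordinate vector. *)
Definition letters z : seq ('I_n.-1 * K) := zip b [seq z 0 k | k <- enum 'I_m].

Lemma letters_word z : unzip1 (letters z) = b.
Proof. by rewrite unzip1_zip // size_map size_enum_ord size_tuple. Qed.

Lemma letters_params z : unzip2 (letters z) = [seq z 0 k | k <- enum 'I_m].
Proof. by rewrite unzip2_zip // size_map size_enum_ord size_tuple. Qed.

Lemma Bword_letters z : Bword b z = word_mx (letters z).
Proof.
rewrite /word_mx /letters -{1}[tval b]map_tnth_enum zip_map big_map.
by rewrite /Bword enumT [index_enum _]unlock.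
Qed.

Lemma letters_surj (s : seq ('I_n.-1 * K)) : unzip1 s = b ->
  exists z, letters z = s.
Proof.
move=> sb; exists (\row_k (unzip2 s)`_k).
rewrite /letters -sb -[RHS]zip_unzip; congr zip.
have sz : size s = m.
  by have := congr1 size sb; rewrite size_map size_tuple.
apply: (@eq_from_nth _ 0) => [|k].
  by rewrite size_map size_enum_ord size_map sz.
rewrite size_map size_enum_ord => km.
by rewrite (nth_map (Ordinal km)) ?size_enum_ord // mxE nth_enum_ord.
Qed.

Definition params_row (M : 'M[K]_n) : 'rV[K]_m := \row_k (word_params b M)`_k.

Lemma params_rowK z : reduced b -> params_row (word_unip (letters z)) = z.
Proof.
move=> red; apply/rowP => k; rewrite mxE -{1}(letters_word z) word_paramsK.
  rewrite letters_params (nth_map k) ?size_enum_ord //.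
  by rewrite nth_ord_enum.
by rewrite letters_word.
Qed.

Lemma alg_Bword (T : Type) (S : (T -> K) -> Prop) (z : T -> 'rV[K]_m) :
  function_algebra S -> (forall k, S (fun t => z t 0 k)) ->
  alg_mx S (fun t => Bword b (z t)).
Proof.
move=> S_alg Sz; rewrite /Bword; elim: (index_enum _) => [|k r IH].
  by move=> i j; under eq_fun do rewrite big_nil; exact: alg_cst.
have -> : (fun t => \prod_(k <- k :: r) Bgen (tnth b k) (z t 0 k)) =
    (fun t => Bgen (tnth b k) (z t 0 k) *m
              \prod_(k <- r) Bgen (tnth b k) (z t 0 k)).
  by apply/funext => t; rewrite big_cons.
apply: alg_mx_mul => // i j; under eq_fun do rewrite mxE /=.
have S_if (c : bool) f g : S f -> S g -> S (fun t => if c then f t else g t).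
  by case: c.
do 3!apply: (S_if _ _ _ (alg_cst S_alg _)).
apply: (S_if _ _ _ (Sz k) (alg_cst S_alg _)).
Qed.

End Letters.

(** * The embedding of the braid variety *)

Section BraidVariety.
Variables (K : fieldType) (n l1 l2 : nat).
Variables (b1 : l1.-tuple 'I_n.-1) (b2 : l2.-tuple 'I_n.-1).
Hypotheses (red1 : reduced b1) (red2 : reduced b2).

Let w1 : 'S_n := coxeter b1.
Let w2 : 'S_n := coxeter b2.
Let v : 'S_n := perm_comp w2 (w0 n).
Let X : set 'rV[K]_(l1 + l2) := braid_variety (cat_tuple b1 b2) (w0 n).
Let B1 (z : 'rV[K]_(l1 + l2)) : 'M[K]_n := Bword b1 (lsubmx z).
Let B2 (z : 'rV[K]_(l1 + l2)) : 'M[K]_n := Bword b2 (rsubmx z).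
Let M1 (z : 'rV[K]_(l1 + l2)) : 'M[K]_n := word_unip (letters b1 (lsubmx z)).
Let M2 (z : 'rV[K]_(l1 + l2)) : 'M[K]_n := word_unip (letters b2 (rsubmx z)).

Lemma Bword_cat z : Bword (cat_tuple b1 b2) z = B1 z *m B2 z.
Proof.
rewrite /B1 /B2 /Bword big_split_ord /=; congr (_ *m _); apply: eq_bigr => k _.
  by rewrite tnth_lshift mxE.
by rewrite tnth_rshift mxE.
Qed.

Lemma word_unip_letters m (b : m.-tuple 'I_n.-1) (z : 'rV[K]_m) : reduced b ->
  unip_supp (coxeter b) (word_unip (letters b z)) /\
  Bword b z = word_unip (letters b z) *m pmat K (coxeter b).
Proof.
move=> red; have := @word_unip_supp K n (letters b z).
rewrite letters_word => /(_ red); split=> //.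
by rewrite Bword_letters word_mxE letters_word.
Qed.

Lemma M1_supp z : unip_supp w1 (M1 z).
Proof. by have [] := word_unip_letters (lsubmx z) red1. Qed.

Lemma B1E z : B1 z = M1 z *m pmat K w1.
Proof. by have [] := word_unip_letters (lsubmx z) red1. Qed.

Lemma M2_supp z : unip_supp w2 (M2 z).
Proof. by have [] := word_unip_letters (rsubmx z) red2. Qed.

Lemma B2E z : B2 z = M2 z *m pmat K w2.
Proof. by have [] := word_unip_letters (rsubmx z) red2. Qed.

Lemma B1_unit z : B1 z \in unitmx.
Proof. by rewrite B1E unitmx_mul pmat_unit (unip_supp_unit (M1_supp z)). Qed.

Lemma B2_unit z : B2 z \in unitmx.
Proof. by rewrite B2E unitmx_mul pmat_unit (unip_supp_unit (M2_supp z)). Qed.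

Lemma B1_inv z : invmx (B1 z) = pmat K w1^-1%g *m invmx (M1 z).
Proof.
apply: (can_inj (mulKmx (B1_unit z))).
rewrite mulmxV ?B1_unit // [in RHS]B1E -mulmxA (mulmxA (pmat K w1)) pmat_mulV.
by rewrite mul1mx mulmxV // (unip_supp_unit (M1_supp z)).
Qed.

Lemma braid_varietyP z : X z <-> borel (B1 z *m B2 z *m pmat K (w0 n)).
Proof.
rewrite /X /braid_variety /= Bword_cat; split=> [tX|[]] //.
by split=> //; rewrite !unitmx_mul B1_unit B2_unit pmat_unit.
Qed.

Lemma braid_variety_closed :
  zariski_closed (fun (z : 'rV[K]_(l1 + l2)) i => z 0 i) X.
Proof.
pose x (z : 'rV[K]_(l1 + l2)) i := z 0 i.
have SB := alg_mx_mul (polyfun_alg x) (alg_Bword (cat_tuple b1 b2) (z := id)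
  (polyfun_alg x) (polyfun_coord x)) (alg_mx_cst (polyfun_alg x) (pmat K (w0 n))).
exists [set p | exists i j : 'I_n, (j < i)%N /\
  forall z, (Bword (cat_tuple b1 b2) z *m pmat K (w0 n)) i j = p.@[x z]].
apply/predeqP => z; split=> [/upper_triangularP tz p [i [j [ji <-]]]|tz].
  exact: tz.
apply/upper_triangularP => i j ji; have [p pE] := SB i j.
by rewrite pE; apply: tz; exists i, j.
Qed.

Lemma invmx_unip_supp w (M : 'M[K]_n) : unip_supp w M ->
  is_trig_mx (invmx M) /\ forall i, invmx M i i = 1.
Proof.
move=> sM; have [tM u1] := unip_supp_trig sM.
exact: lower_unip_inv (unip_supp_unit sM) tM u1.
Qed.

(** The determinant being 1, the adjugate inverts a unipotent matrix by
    polynomials. *)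
Lemma adj_invmx_unip w (M : 'M[K]_n) : unip_supp w M -> \adj (invmx M) = M.
Proof.
move=> sM; have uM := unip_supp_unit sM.
have adjE : invmx (invmx M) = (\det (invmx M))^-1 *: \adj (invmx M).
  by rewrite {1}/invmx unitmx_inv uM.
by rewrite -[RHS]invmxK adjE det_inv (unip_supp_det sM) !invr1 scale1r.
Qed.

(** Conjugation by w_2 takes the matrix into U and conjugation by w_0 brings it
    back to U_-, so B_2 w_0 lies in v U_-. *)
Lemma M2_conj_unip z (N := pmat K v^-1%g *m M2 z *m pmat K v) :
  is_trig_mx N /\ forall i, N i i = 1.
Proof.
have [/upper_triangularP tU U1] := unip_supp_conj (M2_supp z).
have NE i j : N i j =
    (pmat K w2^-1%g *m M2 z *m pmat K w2) (w0 n i) (w0 n j).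
  by rewrite /N !pmat_mulr !pmat_mull !invgK /v !perm_compE.
split=> [|i]; last by rewrite NE U1.
by apply/is_trig_mxP => i j ij; rewrite NE tU // w0_lt.
Qed.

Section Chart.
Variables (P : 'M[K]_n) (uP : P \in unitmx).

Let iota z : flag K n := flag_of (P *m invmx (B1 z)).

(** The charts P w_1^-1 U_- B and P v U_- B are the translates of the big cell that
    contain the two translated cells; the matrices below are in the big cell iff
    the flag of [A] is in the respective chart. *)
Definition chart_iota (A : 'M[K]_n) := pmat K w1 *m invmx P *m A.
Definition chart_opp (A : 'M[K]_n) := pmat K v^-1%g *m invmx P *m A.
Definition chart_den A :=
  big_cell_den (chart_iota A) * big_cell_den (chart_opp A).

(** On the image the first chart contains the inverse of the unipotent matrix of
    the first word, and the second the conjugate by v^-1 of that of the second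
    word. *)
Definition chart_params A : 'rV[K]_(l1 + l2) :=
  row_mx (params_row b1 (\adj (lower_factor (chart_iota A))))
         (params_row b2
            (pmat K v *m lower_factor (chart_opp A) *m pmat K v^-1%g)).

Lemma chart_den_borel A b : borel b ->
  (chart_den (A *m b) != 0) = (chart_den A != 0).
Proof.
move=> bb; rewrite /chart_den !mulf_eq0 !negb_or /chart_iota /chart_opp !mulmxA.
by rewrite !(big_cell_den_borel _ bb).
Qed.

Lemma chart_params_borel A b : borel b ->
  chart_params (A *m b) = chart_params A.
Proof.
move=> bb; rewrite /chart_params /chart_iota /chart_opp !mulmxA.
by rewrite !(lower_factor_borel _ bb).
Qed.

(** As B_1^-1 and B_2 w_0 differ by an element of B, the two charts see the same
    flag through the first and through the second word. *)
Lemma chart_paramsK z : X z ->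
  chart_den (P *m invmx (B1 z)) != 0 /\ chart_params (P *m invmx (B1 z)) = z.
Proof.
move=> /braid_varietyP; set U := _ *m pmat K (w0 n) => bU; have [uU _] := bU.
have iotaE : chart_iota (P *m invmx (B1 z)) = invmx (M1 z).
  by rewrite /chart_iota mulmxA mulmxKV // B1_inv mulmxA pmat_mulV mul1mx.
have oppE : chart_opp (P *m invmx (B1 z)) =
    (pmat K v^-1%g *m M2 z *m pmat K v) *m invmx U.
  rewrite /chart_opp mulmxA mulmxKV // -!mulmxA; congr (_ *m _).
  rewrite /v pmatM !mulmxA -B2E.
  apply: (can_inj (mulKmx (B1_unit z))); rewrite mulmxV ?B1_unit //.
  by rewrite !mulmxA mulmxV.
have [t1 d1] := invmx_unip_supp (M1_supp z).
have [t2 d2] := M2_conj_unip z.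
split.
  rewrite /chart_den iotaE oppE mulf_eq0 negb_or.
  rewrite big_cell_den_borel; last exact: borelV.
  by rewrite !big_cell_den_unip // oner_neq0.
rewrite /chart_params iotaE oppE lower_factor_borel; last exact: borelV.
rewrite !lower_factor_unip // (adj_invmx_unip (M1_supp z)).
rewrite -!mulmxA pmat_mulV mulmx1 !mulmxA pmat_mulV mul1mx.
by rewrite !params_rowK // hsubmxK.
Qed.

(** Every matrix of the flag gives the same value, by [chart_params_borel]. *)
Definition flag_params (F : flag K n) : 'rV[K]_(l1 + l2) :=
  chart_params (xget 0 [set A | A \in unitmx /\ flag_of A = F]).

Lemma flag_params_flag_of A :
  A \in unitmx -> flag_params (flag_of A) = chart_params A.
Proof.
move=> uA; rewrite /flag_params; case: xgetP => [A' _ [uA' AA']|/(_ A)[]] //.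
have [b bb ->] := iffLR (flag_of_eqP uA uA') (esym AA').
by rewrite chart_params_borel.
Qed.

Lemma iota_morphism : morphism (subspace (Aff K (l1 + l2)) X)
  (subspace (Fl K n) (iota @` X)) iota.
Proof.
pose g z := P *m invmx (B1 z).
apply: morphism_corestrict.
- exact: affine_open_setI.
- exact: affine_regular_setI.
- apply: (@morphism_comp _ _ _ _ _ (GL K n) _ g); last exact: morphism_quotient.
  apply: (@morphism_on_sub _ _ _ _ _ setT).
  + apply: affine_polynomial_morphism => k; apply: alg_mxvec.
    have -> : g = fun z =>
        P *m (pmat K w1^-1%g *m \adj (B1 z *m pmat K w1^-1%g)).
      apply/funext => z; rewrite /g B1_inv B1E -[in RHS]mulmxA pmat_mulV mulmx1.
      rewrite /invmx (unip_supp_unit (M1_supp z)) (unip_supp_det (M1_supp z)).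
      by rewrite invr1 scale1r.
    have alg := polyfun_alg (fun (z : 'rV[K]_(l1 + l2)) i => z 0 i).
    do 2!apply: (alg_mx_mul alg (alg_mx_cst alg _)).
    apply: (alg_mx_adj alg); apply: (alg_mx_mul alg _ (alg_mx_cst alg _)).
    apply: (alg_Bword _ alg) => i.
    have -> : (fun z : 'rV[K]_(l1 + l2) => lsubmx z 0 i) =
        (fun z => z 0 (lshift l2 i)) by apply/funext => z; rewrite mxE.
    exact: polyfun_coord.
  + by [].
  + by [].
  + by move=> z _ _; split=> //=; rewrite unitmx_mul uP unitmx_inv B1_unit.
- by move=> z _ Xz; exists z.
Qed.

Lemma chart_den_poly : polyfun (fun (A : 'M[K]_n) k => mxvec A 0 k) chart_den.
Proof.
have alg := polyfun_alg (fun (A : 'M[K]_n) k => mxvec A 0 k).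
apply: alg_mul => //; apply: polyfun_big_cell_den;
  apply: (alg_mx_mul alg (alg_mx_cst alg _));
  exact: polyfun_mxvec.
Qed.

Lemma chart_params_frac i : fracfun (fun (A : 'M[K]_n) k => mxvec A 0 k)
  [set A | chart_den A != 0] (fun A => chart_params A 0 i).
Proof.
set x := fun (A : 'M[K]_n) k => mxvec A 0 k; set D := [set A | _].
have alg := fracfun_alg x D.
have fr (N : 'M[K]_n) : alg_mx (polyfun x) (fun A => N *m A).
  have algP := polyfun_alg x.
  exact: (alg_mx_mul algP (alg_mx_cst algP N) (@polyfun_mxvec K n)).
have f1 : alg_mx (fracfun x D) (fun A => lower_factor (chart_iota A)).
  apply: (@fracfun_lower_factor _ _ _ chart_iota) (fr _) => A.
  by rewrite /D /= /chart_den mulf_eq0 negb_or => /andP[].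
have f2 : alg_mx (fracfun x D) (fun A => lower_factor (chart_opp A)).
  apply: (@fracfun_lower_factor _ _ _ chart_opp) (fr _) => A.
  by rewrite /D /= /chart_den mulf_eq0 negb_or => /andP[].
rewrite /chart_params; case: (splitP i) => k ki.
  have -> : i = lshift l2 k by apply: val_inj.
  under eq_fun do rewrite row_mxEl mxE.
  by apply: alg_word_params => //; apply: alg_mx_adj.
have -> : i = rshift l1 k by apply: val_inj.
under eq_fun do rewrite row_mxEr mxE.
apply: alg_word_params => //.
by do 2![apply: alg_mx_mul => //; try exact: alg_mx_cst].
Qed.

(** On the open set covered by both charts, [flag_params] descends from a rational
    map on matrices; so it extends the inverse map to a neighbourhood of the image,
    as [morphism_on_sub] asks. *)
Lemma flag_params_morphism : morphism (subspace (Fl K n) (iota @` X))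
  (subspace (Aff K (l1 + l2)) X) flag_params.
Proof.
set x := fun (A : 'M[K]_n) k => mxvec A 0 k.
pose D0 := [set A | chart_den A != 0].
pose D : set (flag K n) := @flag_of K n @` (D0 `&` [set A | A \in unitmx]).
have Aff_open U g : regular (Aff K (l1 + l2)) U g -> isopen (Aff K (l1 + l2)) U.
  exact: affine_regular_open.
have DX : D `<=` carrier (Fl K n) by move=> _ [A [_ uA] <-]; exists A.
apply: (@morphism_on_sub _ _ _ _ _ D) => //.
- apply: morphism_on_quotient => //.
  have -> : carrier (GL K n) `&` @flag_of K n @^-1` D =
      D0 `&` [set A | A \in unitmx].
    apply/predeqP => A; split=> [[[_ uA] [A' [dA' uA'] AA']]|[dA uA]]; last first.
      by split=> //; exists A.
    split=> //; have [b bb ->] := iffLR (flag_of_eqP uA' uA) AA'.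
    by rewrite /D0 /= chart_den_borel.
  apply: (morphism_on_subl (f := chart_params)) => //.
    apply: affine_morphism_on; first exact: chart_den_poly.
    exact: chart_params_frac.
  by move=> A _ uA /=; rewrite flag_params_flag_of.
- move=> _ [_ [z Xz <-]]; exists (P *m invmx (B1 z)) => //.
  split; first by have [] := chart_paramsK Xz.
  by rewrite /= unitmx_mul uP unitmx_inv B1_unit.
- move=> _ _ [z Xz <-]; split=> //.
  rewrite flag_params_flag_of ?unitmx_mul ?uP ?unitmx_inv ?B1_unit //.
  by have [_ ->] := chart_paramsK Xz.
Qed.

Lemma iota_affine_isomorphism :
  affine_isomorphism (subspace (Aff K (l1 + l2)) X)
    (subspace (Fl K n) (iota @` X)) iota.
Proof.
have iso : isomorphism (subspace (Aff K (l1 + l2)) X)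
    (subspace (Fl K n) (iota @` X)) iota.
  have paramsK z : X z -> flag_params (iota z) = z.
    move=> Xz; rewrite flag_params_flag_of ?unitmx_mul ?uP ?unitmx_inv ?B1_unit //.
    by have [_ ->] := chart_paramsK Xz.
  split; first exact: iota_morphism.
  exists flag_params; split; first exact: flag_params_morphism.
    by move=> z [_ /paramsK].
  by move=> _ [_ [z Xz <-]]; rewrite paramsK.
split=> //; last first.
  have [g giso] := isomorphism_sym iso.
  by exists (l1 + l2)%N, X, g; split=> //; exact: braid_variety_closed.
exists (l1 + l2)%N, X, id; split; first exact: braid_variety_closed.
apply: isomorphism_id => [U g [[V _ ->] _]|U [V _ ->]] z [_ Xz] //.
Qed.

End Chart.

(** A flag in both cells is that of some B_1(z_1)^-1 and that of some B_2(z_2) w_0;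
    comparing the two gives the equation of the braid variety. *)
Lemma image_iota :
  [set flag_of (invmx (B1 z)) | z in X] =
  schubert w1^-1%g `&` schubert_opp v :> set (flag K n).
Proof.
apply/predeqP => F; split=> [[z Xz <-]|].
  have := iffLR (braid_varietyP z) Xz; set U := _ *m pmat K (w0 n) => bU.
  have uV : invmx (B1 z) \in unitmx by rewrite unitmx_inv B1_unit.
  have b1B : borel (1%:M : 'M[K]_n).
    split; first exact: unitmx1.
    by rewrite /upper_triangular trmx1 scalar_mx_is_trig.
  split.
    pose U1 := pmat K w1^-1%g *m M1 z *m pmat K w1.
    have uU1 : U1 \in unitmx.
      by rewrite 2!unitmx_mul !pmat_unit (unip_supp_unit (M1_supp z)).
    have bU1 : borel U1 by split=> //; have [] := unip_supp_conj (M1_supp z).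
    exists (invmx U1), 1%:M; split=> //; first exact: borelV.
    congr flag_of; apply: (can_inj (mulKmx uU1)).
    rewrite mulmx1 mulKVmx // /U1 -[_ *m M1 z *m _]mulmxA -B1E.
    by rewrite -mulmxA mulmxV ?B1_unit // mulmx1.
  exists (M2 z), 1%:M; split=> //.
    split; first exact: unip_supp_unit (M2_supp z).
    by have [] := unip_supp_trig (M2_supp z).
  rewrite mulmx1 pmatM mulmxA -B2E -(flag_of_mulB uV bU).
  by rewrite /U !mulmxA mulVmx ?B1_unit // mul1mx.
case=> -[b [c [bb bc FE]]] [b' [c' [bb' bc' FE']]].
have [s1 s1E b1s] := word_mx_borel b1 bb.
have [s2 s2E [d bd dE]] := word_mx_borel_opp b2 bb'.
have [z1 z1E] := letters_surj s1E; have [z2 z2E] := letters_surj s2E.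
pose z := row_mx z1 z2.
have B1z : word_mx s1 = B1 z by rewrite /B1 row_mxKl Bword_letters z1E.
have B2z : word_mx s2 = B2 z by rewrite /B2 row_mxKr Bword_letters z2E.
have uV : invmx (B1 z) \in unitmx by rewrite unitmx_inv B1_unit.
have uB2w : B2 z *m pmat K (w0 n) \in unitmx.
  by rewrite unitmx_mul B2_unit pmat_unit.
have F1 : F = flag_of (invmx (B1 z)).
  rewrite FE -(flag_of_mulB uV (borelM b1s bc)) B1z !mulmxA mulVmx ?B1_unit //.
  by rewrite mul1mx.
have F2 : F = flag_of (B2 z *m pmat K (w0 n)).
  rewrite FE' /v pmatM mulmxA dE B2z.
  rewrite -(flag_of_mulB uB2w (borelM (borel_w0 bd) bc')) !mulmxA.
  by rewrite -[B2 z *m pmat K (w0 n) *m pmat K (w0 n)]mulmxA pmat_w0K mulmx1.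
exists z => //; apply/braid_varietyP.
have [e be eE] := iffLR (flag_of_eqP uV uB2w) (etrans (esym F1) F2).
by rewrite -mulmxA eE mulmxA mulmxV ?B1_unit // mul1mx.
Qed.

End BraidVariety.

Theorem theorem4p5 (R : realType) (n l1 l2 : nat)
    (b1 : l1.-tuple 'I_n.-1) (b2 : l2.-tuple 'I_n.-1)
    (hb1 : reduced b1) (hb2 : reduced b2) :
  let w1 : 'S_n := coxeter b1 in
  let w2 : 'S_n := coxeter b2 in
  let X : set 'rV[R[i]]_(l1 + l2) :=
    braid_variety (cat_tuple b1 b2) (w0 n) in
  let iota (z : 'rV[R[i]]_(l1 + l2)) : flag R[i] n :=
    flag_of (invmx (Bword b1 (lsubmx z))) in
  let jmath (z : 'rV[R[i]]_(l1 + l2)) : flag R[i] n :=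
    flag_of (pmat R[i] (w0 n) *m invmx (Bword b1 (lsubmx z))) in
  (affine_isomorphism (subspace (Aff R[i] (l1 + l2)) X)
                      (subspace (Fl R[i] n) (iota @` X)) iota /\
   iota @` X = schubert (w1^-1)%g `&` schubert_opp (perm_comp w2 (w0 n)))
  /\
  (affine_isomorphism (subspace (Aff R[i] (l1 + l2)) X)
                      (subspace (Fl R[i] n) (jmath @` X)) jmath /\
   jmath @` X = schubert_opp (perm_comp (w0 n) (w1^-1)%g) `&` schubert (wstar w2)).
Proof.
move=> w1 w2 X iota jmath.
have iotaE : iota = fun z => flag_of (1%:M *m invmx (Bword b1 (lsubmx z))).
  by apply/funext => z; rewrite mul1mx.
have imE : iota @` X = schubert (w1^-1)%g `&` schubert_opp (perm_comp w2 (w0 n)).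
  exact: image_iota.
have uV (z : 'rV[R[i]]_(l1 + l2)) : invmx (Bword b1 (lsubmx z)) \in unitmx.
  by rewrite unitmx_inv; exact: (B1_unit (l2 := l2) hb1).
split; split; [|exact: imE| |].
- by rewrite iotaE; apply: (iota_affine_isomorphism hb1 hb2); exact: unitmx1.
- by apply: (iota_affine_isomorphism hb1 hb2); exact: pmat_unit.
rewrite /wstar -perm_compA -w0_translate_cells -imE.
apply/predeqP => F; split=> [[z Xz <-]|[A [uA [z Xz zA]] <-]].
  by exists (invmx (Bword b1 (lsubmx z))) => //; split=> //; exists z.
by exists z => //; apply: flag_of_mull => //; exact: pmat_unit.
Qed.
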